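(* Let $N\ge 1$ be a natural number. For every nonempty projection system $\mathcal P$ in $\mathbb C^N$, $$\mathrm{QDisc}(\mathcal P)\le N.$$
   Context: $\mathcal M_N(\mathbb C)$ is the set of $N\times N$ complex matrices. A projection system in $\mathbb C^N$ is a finite set $\mathcal P$ of orthogonal projections of $\mathbb C^N$, i.e. matrices $P\in\mathcal M_N(\mathbb C)$ with $P^2=P=P^*$. A quantum coloring is a Hermitian matrix $\chi\in\mathcal M_N(\mathbb C)$ all of whose eigenvalues lie in $\{1,-1\}$. With $[A,B]=AB-BA$ and $\mathrm{tr}^2(X)=(\mathrm{tr}\,X)^2$, the quantum discrepancy of $\mathcal P$ is $$\mathrm{QDisc}(\mathcal P)=\min_{\chi\ \text{quantum coloring}}\ \max_{P\in\mathcal P}\left[\mathrm{tr}^2(\chi P)+\mathrm{tr}(\chi[\chi,P]P)\right]^{1/2}$$ (the expression in brackets is always real and non-negative). *)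

(* Defs.v *)
From HB Require Import structures.
From mathcomp Require Import all_boot all_order all_algebra.
From mathcomp Require Import sesquilinear spectral complex.
From mathcomp Require Import finmap.
From mathcomp Require Import all_classical all_reals all_analysis.

Set Implicit Arguments.
Unset Strict Implicit.
Unset Printing Implicit Defensive.

Import Order.TTheory GRing.Theory Num.Theory.
Import numFieldNormedType.Exports.

Local Open Scope classical_set_scope.
Local Open Scope fset_scope.
Local Open Scope ring_scope.
Local Open Scope sesquilinear_scope.

(* Complex matrices are matrices over R[i], with R the real numbers. *)
Section Definitions.
Variables (R : realType) (N : nat).
Implicit Types (P chi A B : 'M[R[i]]_N) (Ps : {fset 'M[R[i]]_N}).

Definition orthogonal_projection P := P *m P = P /\ P ^t* = P.

Definition projection_system Ps :=
  forall P, P \in Ps -> orthogonal_projection P.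

Definition quantum_coloring chi :=
  chi \is hermsymmx /\ (forall a, eigenvalue chi a -> a = 1 \/ a = - 1).

Definition commutator A B : 'M[R[i]]_N := A *m B - B *m A.

Definition qdisc_bracket chi P : R[i] :=
  (\tr (chi *m P)) ^+ 2 + \tr (chi *m commutator chi P *m P).

(* The bracket is a nonnegative real (qdisc_bracket_ge0), so taking its real
   part only serves to land in R. *)
Definition qdisc_proj chi P : R := Num.sqrt (complex.Re (qdisc_bracket chi P)).

(* The default value 0 is harmless: the terms are square roots, so they are
   nonnegative. *)
Definition qdisc_coloring Ps chi : R :=
  \big[Num.max/0]_(P <- Ps) qdisc_proj chi P.

(* This infimum is a minimum: see QDisc_attained and QDisc_le. *)
Definition QDisc Ps : R :=
  inf [set qdisc_coloring Ps chi | chi in [set chi | quantum_coloring chi]].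

End Definitions.

Section Facts.
Variables (R : realType) (N : nat).
Implicit Types (P chi A B : 'M[R[i]]_N) (Ps : {fset 'M[R[i]]_N}).

Lemma hermsymmxE A : (A \is hermsymmx) <-> A ^t* = A.
Proof.
split; first by move/is_hermitianmxP; rewrite expr0 scale1r => <-.
by move=> h; apply/is_hermitianmxP; rewrite expr0 scale1r h.
Qed.

Lemma adjM A B : (A *m B) ^t* = B ^t* *m A ^t*.
Proof. by rewrite trmx_mul map_mxM. Qed.

Lemma quantum_coloringP chi :
  quantum_coloring chi <-> chi ^t* = chi /\ chi *m chi = 1%:M.
Proof.
split=> [[chih eig]|[chih chi2]].
  split; first exact/hermsymmxE.
  have /hermitian_normalmx /orthomx_spectralP := chih.
  set U := spectralmx chi; set d := spectral_diag chi => e.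
  have Uu : U \in unitmx := spectral_unit chi.
  have d2 j : d 0 j * d 0 j = 1.
    suff : eigenvalue chi (d 0 j) by move=> /eig[] ->; rewrite ?mulr1 ?mulrNN ?mulr1.
    apply/eigenvalueP; exists (row j U).
      rewrite e -!row_mul !mulmxA mulmxV // mul1mx row_mul row_diag_mx.
      by rewrite -scalemxAl -rowE.
    apply/negP => /eqP r0.
    have := congr1 (row j) (mulmxV Uu).
    rewrite row_mul r0 mul0mx => /rowP/(_ j).
    by rewrite !mxE eqxx => /eqP; rewrite eq_sym oner_eq0.
  have dd : diag_mx d *m diag_mx d = 1%:M.
    by apply/matrixP=> i j; rewrite mulmx_diag !mxE d2.
  rewrite e -!mulmxA (mulmxA U) mulmxV // mul1mx (mulmxA (diag_mx d)) dd.
  by rewrite mul1mx mulVmx.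
split; first exact/hermsymmxE.
move=> a /eigenvalueP [v va v0].
have : (a * a) *: v = v by rewrite -scalerA -va scalemxAl -va -mulmxA chi2 mulmx1.
move/eqP; rewrite -subr_eq0 -[X in _ - X]scale1r -scalerBl scaler_eq0 (negPf v0).
by rewrite orbF subr_eq0 -expr2 sqrf_eq1 => /orP[] /eqP ->; [left|right].
Qed.

Lemma quantum_coloring1 : quantum_coloring (1%:M : 'M[R[i]]_N).
Proof. by apply/quantum_coloringP; rewrite trmx1 map_mx1 mulmx1. Qed.

Lemma tr_adj A : \tr (A ^t*) = (\tr A)^*%R.
Proof. by rewrite /mxtrace rmorph_sum; apply: eq_bigr => i _; rewrite !mxE. Qed.

Lemma tr_adjM_ge0 A : 0 <= \tr (A *m A ^t*).
Proof.
apply: sumr_ge0 => i _; rewrite mxE; apply: sumr_ge0 => j _.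
by rewrite !mxE mul_conjC_ge0.
Qed.

Lemma qdisc_bracket_ge0 chi P :
  quantum_coloring chi -> orthogonal_projection P -> 0 <= qdisc_bracket chi P.
Proof.
move=> /quantum_coloringP[ch c2] [P2 Ph]; rewrite /qdisc_bracket.
apply: addr_ge0.
  rewrite -realEsqr; apply/CrealP.
  by rewrite -tr_adj adjM ch Ph mxtrace_mulC.
have E : (commutator chi P) ^t* = - commutator chi P.
  by rewrite /commutator linearB map_mxB -/(_ ^t*) !adjM ch Ph opprB.
have := tr_adjM_ge0 (commutator chi P); rewrite E /commutator.
have e1 : \tr (P *m chi *m P *m chi) = \tr (chi *m P *m chi *m P).
  by rewrite mxtrace_mulC !mulmxA.
have e2 : \tr (chi *m P *m (P *m chi)) = \tr P.
  by rewrite mulmxA -(mulmxA chi) P2 mxtrace_mulC mulmxA c2 mul1mx.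
have e3 : P *m chi *m (chi *m P) = P.
  by rewrite mulmxA -(mulmxA P) c2 mulmx1 P2.
have e4 : chi *m (chi *m P - P *m chi) *m P = P - chi *m P *m chi *m P.
  by rewrite mulmxBr mulmxA c2 mul1mx mulmxBl P2 !mulmxA.
have e5 : \tr ((chi *m P - P *m chi) *m - (chi *m P - P *m chi)) =
    (\tr P - \tr (chi *m P *m chi *m P)) *+ 2.
  rewrite mulmxN mulmxBl !mulmxBr e3 !linearN /= !linearB /= e2 !mulmxA e1.
  by rewrite !opprK mulr2n [X in X + _]addrC.
by rewrite e5 pmulrn_lge0 // e4 linearB.
Qed.

Lemma qdisc_coloring_ge0 Ps chi : 0 <= qdisc_coloring Ps chi.
Proof.
rewrite /qdisc_coloring; elim/big_rec: _ => // P x _ x0.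
by rewrite le_max x0 orbT.
Qed.

Lemma QDisc_le Ps chi : quantum_coloring chi -> QDisc Ps <= qdisc_coloring Ps chi.
Proof.
move=> cc; apply: ge_inf; last by exists chi.
by exists 0 => _ [c _ <-]; exact: qdisc_coloring_ge0.
Qed.

Section Compactness.
Variable T : topologicalType.
Implicit Types (f g : T -> R[i]).

Let cc f := continuous (fun t => complex.Re (f t) : R) /\
            continuous (fun t => complex.Im (f t) : R).

Let cc_cst (z : R[i]) : cc (fun=> z).
Proof. by split=> t; exact: cvg_cst. Qed.

Let ccN f : cc f -> cc (fun t => - f t).
Proof.
move=> [a b]; split=> t.
  rewrite (_ : (fun _ => _) = (fun t => - complex.Re (f t))); last first.
    by apply/funext => u; case: (f u).
  by apply: cvgN; exact: a.
rewrite (_ : (fun _ => _) = (fun t => - complex.Im (f t))); last first.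
  by apply/funext => u; case: (f u).
by apply: cvgN; exact: b.
Qed.

Let ccD f g : cc f -> cc g -> cc (fun t => f t + g t).
Proof.
move=> [a b] [c d]; split=> t.
  rewrite (_ : (fun _ => _) = (fun t => complex.Re (f t) + complex.Re (g t))).
    by apply: cvgD; [exact: a|exact: c].
  by apply/funext => u; case: (f u); case: (g u).
rewrite (_ : (fun _ => _) = (fun t => complex.Im (f t) + complex.Im (g t))).
  by apply: cvgD; [exact: b|exact: d].
by apply/funext => u; case: (f u); case: (g u).
Qed.

Let ccM f g : cc f -> cc g -> cc (fun t => f t * g t).
Proof.
move=> [a b] [c d]; split=> t.
  rewrite (_ : (fun _ => _) = (fun t => complex.Re (f t) * complex.Re (g t)
                                      - complex.Im (f t) * complex.Im (g t))).
    by apply: cvgB; apply: cvgM; [exact: a|exact: c|exact: b|exact: d].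
  by apply/funext => u; case: (f u); case: (g u).
rewrite (_ : (fun _ => _) = (fun t => complex.Re (f t) * complex.Im (g t)
                                    + complex.Im (f t) * complex.Re (g t))).
  by apply: cvgD; apply: cvgM; [exact: a|exact: d|exact: b|exact: c].
by apply/funext => u; case: (f u) => ? ?; case: (g u) => ? ?.
Qed.

Let ccJ f : cc f -> cc (fun t => (f t)^*%R).
Proof.
move=> [a b]; split=> t.
  rewrite (_ : (fun _ => _) = (fun t => complex.Re (f t))); last first.
    by apply/funext => u; case: (f u).
  exact: a.
rewrite (_ : (fun _ => _) = (fun t => - complex.Im (f t))); last first.
  by apply/funext => u; case: (f u).
by apply: cvgN; exact: b.
Qed.

Let cc_sum (F : 'I_N -> T -> R[i]) :
  (forall i, cc (F i)) -> cc (fun t => \sum_i F i t).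
Proof.
move=> h; elim: (index_enum _) => [|i s ih].
  by rewrite (_ : (fun _ => _) = fun=> 0)//; apply/funext => t; rewrite big_nil.
rewrite (_ : (fun _ => _) = fun t => F i t + \sum_(j <- s) F j t); last first.
  by apply/funext => t; rewrite big_cons.
exact: ccD.
Qed.

Definition cont_mx (F : T -> 'M[R[i]]_N) := forall i j, cc (fun t => F t i j).

Lemma cont_mx_cst A : cont_mx (fun=> A).
Proof. by move=> i j; exact: cc_cst. Qed.

Lemma cont_mxB F G : cont_mx F -> cont_mx G -> cont_mx (fun t => F t - G t).
Proof.
move=> f g i j.
rewrite (_ : (fun _ => _) = (fun t => F t i j + - G t i j)).
  exact/ccD/ccN.
by apply/funext => t; rewrite !mxE.
Qed.

Lemma cont_mxM F G : cont_mx F -> cont_mx G -> cont_mx (fun t => F t *m G t).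
Proof.
move=> f g i j.
rewrite (_ : (fun _ => _) = (fun t => \sum_k F t i k * G t k j)).
  by apply: (@cc_sum (fun k t => F t i k * G t k j)) => k; exact: ccM.
by apply/funext => t; rewrite !mxE.
Qed.

Lemma cont_mxJ F : cont_mx F -> cont_mx (fun t => (F t) ^t*).
Proof.
move=> f i j.
rewrite (_ : (fun _ => _) = (fun t => (F t j i)^*%R)); first exact: ccJ.
by apply/funext => t; rewrite !mxE.
Qed.

Lemma cont_mx_closed F G : cont_mx F -> cont_mx G -> closed [set t | F t = G t].
Proof.
move=> f g.
rewrite (_ : [set _ | _] = \bigcap_(ij in [set: 'I_N * 'I_N])
  ((fun t => complex.Re ((F t - G t) ij.1 ij.2)) @^-1` [set 0] `&`
   (fun t => complex.Im ((F t - G t) ij.1 ij.2)) @^-1` [set 0])%classic).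
  apply: closed_bigI => -[i j] _.
  have [a b] := cont_mxB f g i j.
  apply: closedI.
    by move/continuous_closedP: a; apply; exact: closed_eq.
  by move/continuous_closedP: b; apply; exact: closed_eq.
apply/seteqP; split=> t /=.
  by move=> h ij _ /=; rewrite h subrr mxE.
move=> h; apply/eqP; rewrite -subr_eq0; apply/eqP/matrixP => i j.
have [/= a b] := h (i, j) I.
by rewrite [RHS]mxE; move: a b; case: (fun_of_matrix _ i j) => x y /= -> ->.
Qed.

Lemma cont_qdisc_proj F P : cont_mx F ->
  continuous (fun t => qdisc_proj (F t) P : R).
Proof.
move=> f t; rewrite /qdisc_proj.
apply: (@continuous_comp _ _ _
  (fun t => complex.Re (qdisc_bracket (F t) P) : R) Num.sqrt);
  last exact: sqrt_continuous.
have tr G : cont_mx G -> cc (fun t => \tr (G t)).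
  by move=> g; apply: (@cc_sum (fun i t => G t i i)) => i; exact: g.
have cP := cont_mx_cst P.
have fP := cont_mxM f cP.
suff [] : cc (fun t => qdisc_bracket (F t) P) by move=> h _; exact: h.
apply: ccD; first by apply: (ccM (tr _ fP) (tr _ fP)).
apply: tr; apply: cont_mxM => //; apply: cont_mxM => //.
by apply: cont_mxB => //; exact: cont_mxM.
Qed.

Lemma cont_qdisc_coloring F Ps : cont_mx F ->
  continuous (fun t => qdisc_coloring Ps (F t) : R).
Proof.
move=> f; rewrite /qdisc_coloring; elim: (enum_fset Ps) => [|P s ih] t.
  rewrite (_ : (fun _ => _) = fun=> 0); first exact: cvg_cst.
  by apply/funext => u; rewrite big_nil.
rewrite (_ : (fun _ => _) = (fun t => qdisc_proj (F t) P : R^o) \max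
    (fun t => \big[Num.max/0]_(P <- s) qdisc_proj (F t) P : R^o)).
  exact: (continuous_max (@cont_qdisc_proj F P f t) (ih t)).
by apply/funext => u; rewrite big_cons.
Qed.

End Compactness.

Let mx_of (v : 'rV[R]_(N * N + N * N)) : 'M[R[i]]_N :=
  \matrix_(i, j) Complex (vec_mx (lsubmx v) i j) (vec_mx (rsubmx v) i j).

Let rV_of A : 'rV[R]_(N * N + N * N) :=
  row_mx (mxvec (map_mx (@complex.Re R) A)) (mxvec (map_mx (@complex.Im R) A)).

Let rV_ofK A : mx_of (rV_of A) = A.
Proof.
apply/matrixP => i j; rewrite /mx_of /rV_of row_mxKl row_mxKr !mxvecK !mxE.
by case: (A i j).
Qed.

Let cont_mx_of : cont_mx mx_of.
Proof.
move=> i j; split.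
  rewrite (_ : (fun _ => _) = (fun v : 'rV[R]_(N * N + N * N) =>
     v 0 (lshift _ (mxvec_index i j)))); first exact: coord_continuous.
  by apply/funext => v; rewrite !mxE.
rewrite (_ : (fun _ => _) = (fun v : 'rV[R]_(N * N + N * N) =>
   v 0 (rshift _ (mxvec_index i j)))); first exact: coord_continuous.
by apply/funext => v; rewrite !mxE.
Qed.

Let coloring_entry chi i j : quantum_coloring chi ->
  (complex.Re (chi i j)) ^+ 2 + (complex.Im (chi i j)) ^+ 2 <= 1.
Proof.
move=> /quantum_coloringP[ch c2]; rewrite -lecR add_Re2_Im2 rmorph1.
have /matrixP/(_ i i) := c2; rewrite -{2}ch mxE [in RHS]mxE eqxx mulr1n => <-.
rewrite (bigD1 j) //= !mxE normCK lerDl; apply: sumr_ge0 => k _.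
by rewrite !mxE mul_conjC_ge0.
Qed.

Lemma QDisc_attained Ps :
  exists2 chi, quantum_coloring chi & qdisc_coloring Ps chi = QDisc Ps.
Proof.
pose K := [set v | quantum_coloring (mx_of v)].
have Kcl : closed K.
  rewrite (_ : K = [set v | (mx_of v) ^t* = mx_of v] `&`
                   [set v | mx_of v *m mx_of v = 1%:M])%classic.
    apply: closedI; apply: cont_mx_closed => //; first exact: cont_mxJ.
      exact: cont_mxM.
    exact: cont_mx_cst.
  by apply/seteqP; split=> v /quantum_coloringP.
have Kbd : bounded_set K.
  exists 1; split=> // M M1 v Kv; apply: le_trans (ltW M1).
  rewrite [leLHS]/Num.norm /= mx_normrE; apply/bigmax_leP; split => //= -[k0 k] _ /=.
  rewrite ord1 -[leRHS](@ger0_norm _ 1) // -ler_sqr ?nnegrE // !real_normK ?num_real //.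
  rewrite expr1n.
  case: (split_ordP k) => l ->; case/mxvec_indexP: l => i j;
    have := coloring_entry i j Kv; rewrite !mxE /=; apply: le_trans;
    by rewrite ?lerDl ?lerDr sqr_ge0.
have Kco := bounded_closed_compact Kbd Kcl.
have K0 : K !=set0.
  by exists (rV_of 1%:M); rewrite /K /= rV_ofK; exact: quantum_coloring1.
have [|v /set_mem Kv vmin] := @EVT_min_rV _ _
   (fun v => qdisc_coloring Ps (mx_of v)) K K0 Kco.
  by apply: continuous_subspaceT; exact: cont_qdisc_coloring.
exists (mx_of v) => //; apply/le_anti/andP; split; last exact: QDisc_le.
apply: lb_le_inf; first by exists (qdisc_coloring Ps (mx_of v)), (mx_of v).
move=> _ [chi /= cc <-]; rewrite -(rV_ofK chi); apply: vmin.
by apply/mem_set; rewrite /K /= rV_ofK.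
Qed.

End Facts.

(* Main.v *)
(* The trivial coloring chi = 1 already suffices: it commutes with every P, so
   the bracket reduces to tr(P)^2, and 0 <= tr P <= N since P and 1 - P are both
   of the form A A^*. *)
Require Import Defs.
From mathcomp Require Import all_boot all_order all_algebra.
From mathcomp Require Import complex finmap.
From mathcomp Require Import all_reals.
Import Order.TTheory GRing.Theory Num.Theory.

Local Open Scope ring_scope.

Section Projections.
Context {R : realType} {N : nat}.
Implicit Types P : 'M[R[i]]_N.

(** A minimum is bounded by its value at one coloring ([QDisc_le]). At the identity the commutator
    vanishes ([qdisc_bracket1]), so each term is the trace of a projection, which lies between [0]
    and [N] ([tr_projection_ge0], [tr_projection_le]). *)

Lemma orthogonal_projection_compl P :
  orthogonal_projection P -> orthogonal_projection (1%:M - P).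
Proof.
move=> [P2 Ph]; split.
  by rewrite mulmxBl mul1mx mulmxBr mulmx1 P2 subrr subr0.
by rewrite linearB /= map_mxB Ph trmx1 map_mx1.
Qed.

(** Since [P] equals [P] times its adjoint, its trace is the sum of the squared moduli of its
    entries. *)
Lemma tr_projection_ge0 P : orthogonal_projection P -> 0 <= \tr P.
Proof. by move=> [P2 Ph]; have := tr_adjM_ge0 P; rewrite Ph P2. Qed.

Lemma tr_projection_le P : orthogonal_projection P -> \tr P <= N%:R.
Proof.
move=> /orthogonal_projection_compl/tr_projection_ge0.
by rewrite linearB /= mxtrace1 subr_ge0.
Qed.

Lemma qdisc_bracket1 P : qdisc_bracket 1%:M P = (\tr P) ^+ 2.
Proof.
by rewrite /qdisc_bracket /commutator mulmx1 !mul1mx subrr mul0mx mxtrace0 addr0.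
Qed.

Lemma qdisc_proj1_le P : orthogonal_projection P -> qdisc_proj 1%:M P <= N%:R.
Proof.
move=> Pp; rewrite /qdisc_proj qdisc_bracket1.
have : (\tr P) ^+ 2 <= ((N%:R ^+ 2 : R)%:C)%C.
  by rewrite rmorphXn rmorph_nat /= lerXn2r ?nnegrE ?ler0n
             ?tr_projection_ge0 ?tr_projection_le.
(* The order on [R[i]] requires equal imaginary parts and compares real parts; only the latter
   matters under the square root. *)
rewrite lecE => /andP[_ le_Re].
apply: le_trans (ler_wsqrtr le_Re) _.
by rewrite sqrtr_sqr ger0_norm.
Qed.

End Projections.

Theorem theorem2 (R : realType) (N : nat) (hN : (1 <= N)%N)
    (Ps : {fset 'M[R[i]]_N}) (hPs : projection_system Ps)
    (Ps_neq0 : Ps <> fset0) :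
  QDisc Ps <= N%:R.
Proof.
apply: le_trans (QDisc_le Ps (quantum_coloring1 R N)) _.
rewrite /qdisc_coloring big_seq_cond.
(* The base case is the default value [0] of the maximum. *)
elim/big_rec: _ => [|P x]; first exact: ler0n.
by rewrite andbT => /hPs/qdisc_proj1_le leP lex; rewrite ge_max leP lex.
Qed.
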